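(* Let $V$ and $W$ be finite-dimensional real inner product spaces, let $A\colon V\to V$ be a symmetric positive semidefinite linear operator, and let $B\colon V\to W$ be a surjective linear operator with $\mathcal{N}(A)\cap\mathcal{N}(B)=\{0\}$. Let $W_0=\{Bv : v\in\mathcal{N}(A)\}^{\perp}\subset W$, let $P\colon W\to W_0$ be the orthogonal projection onto $W_0$, and let $S_0=P\,B\,A^{+}B^t\,P^t\colon W_0\to W_0$, where $A^+$ is a pseudoinverse of $A$. Then $$\lambda_{\min}(S_0)=\inf_{0\neq q\in W_0}\ \sup_{v\in\mathcal{R}(A),\ PBv=q}\frac{\|q\|^2}{(Av,v)},\qquad \lambda_{\max}(S_0)=\sup_{0\neq v\in\mathcal{R}(A)}\frac{\|PBv\|^2}{(Av,v)}.$$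
   Context: All inner products are denoted $(\cdot,\cdot)$ with associated norms $\|\cdot\|$; $W_0$ carries the inner product of $W$. $\mathcal{N}(\cdot)$ and $\mathcal{R}(\cdot)$ denote null space and range; $L^t$ denotes the adjoint of a linear operator $L$; in particular $P^t\colon W_0\to W$ is the adjoint of $P\colon W\to W_0$ (the inclusion of $W_0$ in $W$). $X^\perp$ is the orthogonal complement of $X$. A pseudoinverse of $A$ is a linear operator $A^+\colon V\to V$ such that $AA^+$ acts as the identity on $\mathcal{R}(A)$; $S_0$ does not depend on the choice of $A^+$. ''Symmetric positive semidefinite'' means self-adjoint with $(Av,v)\ge 0$ for all $v$. $S_0$ is the projected Schur complement of the saddle point system $Au+B^tp=f$, $Bu=g$ (with $f\in V$, $g\in W$). $\lambda_{\min}$ and $\lambda_{\max}$ denote the minimum and maximum eigenvalues of an operator (so $W_0$ is understood to be nonzero). *)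

(* Defs.v *)
From HB Require Import structures.
From mathcomp Require Import all_boot all_order all_algebra.
From mathcomp Require Import all_classical all_reals ereal.

Set Implicit Arguments.
Unset Strict Implicit.
Unset Printing Implicit Defensive.

Import Order.TTheory GRing.Theory Num.Theory.

Local Open Scope ring_scope.

(* Over a real field, {dot U for idfun} is the type of inner products on U:  *)
(* the hermitian symmetry condition for idfun is plain symmetry.             *)

Definition dnorm (R : rcfType) (U : lmodType R) (d : {dot U for idfun})
  (u : U) : R := Num.sqrt (d u u).

Section SubspaceDot.
Variables (R : realFieldType) (W : vectType R) (d : {dot W for idfun}).
Variable U : {vspace W}.

Definition subvs_form (u v : subvs_of U) : R := d (vsval u) (vsval v).

Fact subvs_form_is_bilinear :
  bilinear_for
    (GRing.Scale.Law.clone _ _ *%R _)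
    (GRing.Scale.Law.clone _ _ (idfun \; *%R) _) subvs_form.
Proof.
by split=> u a v w; rewrite /subvs_form linearP //; apply: linearPl.
Qed.

HB.instance Definition _ :=
  bilinear_isBilinear.Build R (subvs_of U) (subvs_of U) R _ _ subvs_form
    subvs_form_is_bilinear.

Fact subvs_form_sym u v :
  subvs_form u v = (-1) ^+ false * idfun (subvs_form v u).
Proof. exact: (@hermC R false idfun W d (vsval u) (vsval v)). Qed.

HB.instance Definition _ :=
  isHermitianSesquilinear.Build R (subvs_of U) false idfun subvs_form
    subvs_form_sym.

Fact subvs_form_gt0 u : u != 0 -> 0 < subvs_form u u.
Proof.
move=> u0; apply: neq0_dnorm_gt0; apply: contra_neq u0 => u0.
by apply: val_inj; rewrite /= u0.
Qed.

HB.instance Definition _ :=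
  isDotProduct.Build R (subvs_of U) subvs_form subvs_form_gt0.

Definition subvs_dot : {dot (subvs_of U) for idfun} := subvs_form.

End SubspaceDot.

Lemma linfunE_linear (F : fieldType) (U V : vectType F) (f : U -> V) :
  linear f -> linfun f =1 f.
Proof.
move=> f_lin u.
pose g : {linear U -> V} := HB.pack f (GRing.isLinear.Build _ _ _ _ _ f_lin).
exact: (lfunE g).
Qed.

Section Adjoint.
Variables (R : realFieldType) (U V : vectType R).
Variables (dU : {dot U for idfun}) (dV : {dot V for idfun}).

Definition is_adjoint (f : 'Hom(U, V)) (g : 'Hom(V, U)) : Prop :=
  forall u v, dV (f u) v = dU u (g v).

(* The default value 0 is never used, see adjointP. *)
Definition adjoint (f : 'Hom(U, V)) : 'Hom(V, U) :=
  xget 0 [set g | is_adjoint f g]%classic.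

Lemma dot_inj u v : (forall w, dU w u = dU w v) -> u = v.
Proof.
move=> uv; apply/eqP; rewrite -subr_eq0; apply/negPn/negP.
by move=> /(neq0_dnorm_gt0 (s := dU)); rewrite linearBr /= uv subrr ltxx.
Qed.

Lemma dot_riesz (l : U -> R^o) :
  linear l -> exists u, forall w, l w = dU w u.
Proof.
move=> l_lin.
have dl_lin u : linear (fun w => dU w u : R^o).
  by move=> a v w; rewrite linearPl.
pose dl u : 'Hom(U, R^o) := linfun (fun w => dU w u : R^o).
have dlE u w : dl u w = dU w u by rewrite linfunE_linear.
have J_lin : linear dl.
  move=> a u v; apply/lfunP => w.
  by rewrite add_lfunE scale_lfunE !dlE linearP.
pose J := linfun dl.
have J_inj : lker J == 0%VS.
  apply/lker0P => u v; rewrite !linfunE_linear // => uv.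
  by apply: dot_inj => w; rewrite -!dlE uv.
have J_full : limg J = fullv.
  apply/eqP; rewrite eqEdim subvf limg_dim_eq ?(eqP J_inj) ?capv0 //.
  by rewrite !dimvf /dim /= muln1.
have /memv_imgP[u _ lu] : linfun l \in limg J by rewrite J_full memvf.
exists u => w; rewrite -dlE -[dl u](linfunE_linear J_lin) -/J -lu.
by rewrite linfunE_linear.
Qed.

Lemma adjointP f : is_adjoint f (adjoint f).
Proof.
suff fP : exists g, is_adjoint f g by exact: (xgetPex 0 fP).
have fv_lin v : linear (fun u => dV (f u) v : R^o).
  by move=> a u w; rewrite linearP linearPl.
have /choice[g gP] v := dot_riesz (fv_lin v).
have g_lin : linear g.
  move=> a u v; apply: dot_inj => w.
  by rewrite linearP /= -!gP linearP.
by exists (linfun g) => u v; rewrite linfunE_linear.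
Qed.

Lemma adjoint_unique f g : is_adjoint f g -> g = adjoint f.
Proof.
move=> fg; apply/lfunP => v; apply: dot_inj => w.
by rewrite -fg adjointP.
Qed.

End Adjoint.

Section OrthogonalProjection.
Variables (R : realFieldType) (W : vectType R) (d : {dot W for idfun}).
Variable U : {vspace W}.

(* daddv_pi U (orthov d U) is an endomorphism of W with image U; composing *)
(* with vsproj U only changes its codomain to the vectType subvs_of U.     *)
Definition orthoproj : 'Hom(W, subvs_of U) :=
  (linfun (vsproj U) \o daddv_pi U (orthov d U))%VF.

Lemma orthov_capv : (U :&: orthov d U = 0)%VS.
Proof.
apply/eqP; rewrite -subv0; apply/subvP => u; rewrite memv_cap memv0.
case/andP => uU /mem_orthovP/(_ u uU) uu; apply/negPn/negP.
by move=> /(neq0_dnorm_gt0 (s := d)); rewrite uu ltxx.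
Qed.

Lemma orthov_addv : (U + orthov d U = fullv)%VS.
Proof.
apply/eqP; rewrite eqEsubv subvf; apply/subvP => w _.
pose incl : 'Hom(subvs_of U, W) := linfun (@vsval R W U).
pose p := vsval (adjoint (subvs_dot d U) d incl w).
rewrite -[w](subrK p) addrC memv_add ?subvsP //.
apply/mem_orthovP => v vU.
have := adjointP (subvs_dot d U) d incl (Subvs vU) w.
rewrite lfunE /= => e.
rewrite hermC expr0 mul1r /= linearBr /= e.
by rewrite /subvs_dot /= /subvs_form /= subrr.
Qed.

Lemma orthoprojE w : vsval (orthoproj w) = daddv_pi U (orthov d U) w.
Proof. by rewrite comp_lfunE lfunE /= vsprojK // memv_pi. Qed.

Lemma orthoprojP w : w - vsval (orthoproj w) \in orthov d U.
Proof.
have w_split : w \in (U + orthov d U)%VS by rewrite orthov_addv memvf.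
rewrite orthoprojE -[X in X - _](daddv_pi_add orthov_capv w_split).
by rewrite addrAC subrr add0r memv_pi.
Qed.

Lemma adjoint_orthoproj (q : subvs_of U) :
  adjoint d (subvs_dot d U) orthoproj q = vsval q.
Proof.
apply: (dot_inj (dU := d)) => w.
rewrite -adjointP /subvs_dot /= /subvs_form.
have /mem_orthovP/(_ _ (subvsP q)) := orthoprojP w.
by rewrite linearBl => /eqP; rewrite subr_eq0 => /eqP.
Qed.

End OrthogonalProjection.

Section Operators.
Variables (R : realFieldType) (V W : vectType R).
Variables (dV : {dot V for idfun}) (dW : {dot W for idfun}).

Definition sym_psd (A : 'End(V)) : Prop :=
  is_adjoint dV dV A A /\ forall v, 0 <= dV (A v) v.

Definition is_pseudoinverse (A Ap : 'End(V)) : Prop :=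
  {in limg A, forall u, A (Ap u) = u}.

Definition W0 (A : 'End(V)) (B : 'Hom(V, W)) : {vspace W} :=
  orthov dW (B @: lker A)%VS.

Definition projW0 (A : 'End(V)) (B : 'Hom(V, W)) : 'Hom(W, subvs_of (W0 A B)) :=
  orthoproj dW (W0 A B).

Definition S0 (A : 'End(V)) (B : 'Hom(V, W)) (Ap : 'End(V)) :
    'End(subvs_of (W0 A B)) :=
  (projW0 A B \o B \o Ap \o adjoint dV dW B
     \o adjoint dW (subvs_dot dW (W0 A B)) (projW0 A B))%VF.

End Operators.

Definition is_lambda_min (R : realFieldType) (U : vectType R) (f : 'End(U))
    (l : R) : Prop :=
  passmx.leigenvalue f l /\ forall m, passmx.leigenvalue f m -> l <= m.

Definition is_lambda_max (R : realFieldType) (U : vectType R) (f : 'End(U))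
    (l : R) : Prop :=
  passmx.leigenvalue f l /\ forall m, passmx.leigenvalue f m -> m <= l.

(* Main.v *)
Require Import Defs.
From mathcomp Require Import all_boot all_order all_algebra.
From mathcomp Require Import all_classical all_reals ereal.
From mathcomp Require Import ring lra.

Import Order.TTheory GRing.Theory Num.Theory.
Local Open Scope ring_scope.
Local Open Scope classical_set_scope.

(** Write C = P B and C^t = B^t P^t, so that S = C A^+ C^t, and put
    T = A^+ C^t.  The definition of W_0 says exactly that C vanishes on the
    null space of A; dually, C^t takes its values in the range of A, whence
    A T = C^t and

      (C v, p) = (A T p, v),      (S p, r) = (A T p, T r).

    So S is the pull-back by T of the form of A: it is self-adjoint and
    positive, and definite because C^t is injective, B being surjective.  The
    Cauchy-Schwarz inequality for the form of A reads

      (C v, p)^2 <= (S p, p) (A v, v),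

    and equality is reached in the range of A, by the component of T p there,
    which C maps to S p.  Both formulas follow from this inequality.
    - Taking p = C v and (S p, p) <= lmax (p, p) bounds the quotient of the
      second formula by lmax; the vector v attached to an eigenvector p reaches
      this bound.
    - For q = S r, the vector v attached to r gives a quotient
      (S r, S r) / (S r, r), which is at least lmin; when q = p is an
      eigenvector for lmin, the inequality shows that no v with C v = p gives
      more than lmin.

    The extreme eigenvalues are obtained without compactness or a spectral
    decomposition: the supremum l of the Rayleigh quotients of a self-adjoint S
    is an eigenvalue, for otherwise the positive semidefinite operator l - S
    would be invertible, and the boundedness of its inverse would keep the
    Rayleigh quotients away from l. *)

(** * Inner products over a real field *)

Section DotTheory.
Context {R : realFieldType} {U : vectType R} (d : {dot U for idfun}).

Lemma dotC (u v : U) : d u v = d v u.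
Proof. by rewrite hermC expr0 mul1r. Qed.

Lemma dot_ge0 (u : U) : 0 <= d u u.
Proof.
have [->|u0] := eqVneq u 0; first by rewrite linear0r.
by rewrite ltW //; apply: neq0_dnorm_gt0.
Qed.

Lemma dot_gt0 (u : U) : (0 < d u u) = (u != 0).
Proof.
apply/idP/idP => [|u0]; last exact: neq0_dnorm_gt0.
by apply: contraTneq => ->; rewrite linear0r ltxx.
Qed.

(** Applied to the identity this is the usual inequality; applied to [A] and
    to [l - S] it drives the whole proof. *)
Lemma sym_psd_CauchySchwarz (T : 'End(U)) (u v : U) : sym_psd d T ->
  d (T u) v ^+ 2 <= d (T u) u * d (T v) v.
Proof.
case=> T_sym T_ge0.
have T_comb a b : 0 <= a ^+ 2 * d (T u) u + 2 * a * b * d (T u) v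
                       + b ^+ 2 * d (T v) v.
  have -> : a ^+ 2 * d (T u) u + 2 * a * b * d (T u) v + b ^+ 2 * d (T v) v
           = d (T (a *: u + b *: v)) (a *: u + b *: v).
    have e : d (T v) u = d (T u) v by rewrite T_sym dotC.
    rewrite !linearD !linearZ /= !linearDl /= !linearZl_LR /= e.
    ring.
  exact: T_ge0.
(* The first two combinations give the inequality multiplied by (Tv, v),
   respectively (Tu, u); the third one, with value - 2 (Tu, v)^2, serves when
   both of these vanish. *)
have := T_ge0 u; have := T_ge0 v.
have := T_comb (d (T v) v) (- d (T u) v).
have := T_comb (- d (T u) v) (d (T u) u).
have := T_comb (- d (T u) v) 1.
set x := d (T u) u; set y := d (T v) v; set z := d (T u) v.
move=> z_ge y_ge x_ge y0 x0.
have [x_gt0|] := ltP 0 x.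
  rewrite -subr_ge0 -(pmulr_rge0 _ x_gt0); lra.
move=> x_le0; have {x0 x_le0} x0 : x = 0 by apply/eqP; rewrite eq_le x_le0.
have [y_gt0|] := ltP 0 y.
  rewrite -subr_ge0 -(pmulr_rge0 _ y_gt0); lra.
move=> y_le0; have {y0 y_le0} y0 : y = 0 by apply/eqP; rewrite eq_le y_le0.
by move: z_ge; rewrite x0 y0; lra.
Qed.

Lemma id_sym_psd : sym_psd d \1%VF.
Proof. by split=> [u v|u]; rewrite !id_lfunE // dot_ge0. Qed.

Lemma dot_CauchySchwarz (u v : U) : d u v ^+ 2 <= d u u * d v v.
Proof. by have := sym_psd_CauchySchwarz _ u v id_sym_psd; rewrite !id_lfunE. Qed.

(** In a basis, the form of [L] at [q] is the sum of the products of the i-th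
    coordinate of [q], which is the inner product of [q] with a Riesz vector,
    by the inner product of [q] with the image of the i-th basis vector;
    Cauchy-Schwarz bounds the square of each factor by a multiple of
    [d q q]. *)
Lemma lfun_form_bounded (L : 'End(U)) :
  exists2 M : R, 0 < M & forall q, d (L q) q <= M * d q q.
Proof.
pose X := vbasis {:U}.
have coord_riesz i : exists u, forall q, coord X i q = d q u.
  apply: (@dot_riesz _ _ d (fun q => coord X i q : R^o)) => a u v.
  exact: linearP.
have /choice[c cP] := coord_riesz.
pose M := 1 + \sum_i (d (c i) (c i) + d (L X`_i) (L X`_i)).
have M_ge0 : 0 <= \sum_i (d (c i) (c i) + d (L X`_i) (L X`_i)).
  by apply: sumr_ge0 => i _; rewrite addr_ge0 ?dot_ge0.
exists M => [|q]; first by rewrite ltr_pwDl.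
have dLq : d (L q) q = \sum_i d q (c i) * d (L X`_i) q.
  rewrite {1}(coord_vbasis (memvf q)) linear_sum /= linear_sumlz.
  by apply: eq_bigr => i _; rewrite linearZ /= linearZl_LR -cP.
rewrite dLq (le_trans (y := (\sum_i (d (c i) (c i) + d (L X`_i) (L X`_i))) * d q q)) //.
  rewrite mulr_suml; apply: ler_sum => i _.
  (* x y <= x ^ 2 + y ^ 2, then Cauchy-Schwarz on both squares. *)
  have := dot_CauchySchwarz q (c i); have := dot_CauchySchwarz (L X`_i) q.
  nra.
by rewrite ler_wpM2r ?dot_ge0 // /M lerDr.
Qed.

End DotTheory.

(** * Extreme eigenvalues of a self-adjoint operator *)

Lemma leigenvalueP {F : fieldType} {U : vectType F} (S : 'End(U)) (m : F) :
  reflect (exists2 q, q != 0 & S q = m *: q) (passmx.leigenvalue S m).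
Proof.
have ker_eig q : (q \in passmx.leigenspace S m) = (S q == m *: q).
  by rewrite memv_ker add_lfunE opp_lfunE scale_lfunE id_lfunE subr_eq0.
apply: (iffP idP) => [Sm|[q q0 Sq]].
  exists (vpick (passmx.leigenspace S m)); first by rewrite vpick0.
  by apply/eqP; rewrite -ker_eig memv_pick.
apply: contraNneq q0 => E0; have := ker_eig q.
by rewrite E0 memv0 Sq eqxx => ->.
Qed.

Section SelfAdjoint.
Context {R : realType} {U : vectType R} (d : {dot U for idfun}).

(** The eigenvalue is the supremum [l] of the Rayleigh quotients.  If
    [T = l - S] were injective, the Cauchy-Schwarz inequality of its form at
    [q] and [T^-1 q] would give [d q q <= N * d (T q) q], where [N] bounds the
    form of [T^-1], so that [l - N^-1] would still bound the quotients. *)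
Lemma self_adjoint_lambda_max (S : 'End(U)) (q0 : U) : q0 != 0 ->
  is_adjoint d d S S ->
  exists2 l, is_lambda_max S l & forall q, d (S q) q <= l * d q q.
Proof.
move=> q0_neq0 S_sym.
pose E := [set d (S q) q / d q q | q in [set q | q != 0]].
have E_neq0 : E !=set0 by exists (d (S q0) q0 / d q0 q0), q0.
have [M M_gt0 S_le] := lfun_form_bounded d S.
have E_ub : has_ubound E.
  by exists M => _ [q q_neq0 <-]; rewrite ler_pdivrMr ?dot_gt0.
pose l := sup E.
have S_le_l q : d (S q) q <= l * d q q.
  have [->|q_neq0] := eqVneq q 0; first by rewrite !linear0r mulr0.
  by rewrite -ler_pdivrMr ?dot_gt0 //; apply: ub_le_sup => //; exists q.
exists l => //; split=> [|m /leigenvalueP[q q_neq0 Sq]]; last first.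
  by rewrite -(ler_pM2r (x := d q q)) ?dot_gt0 // -linearZl_LR /= -Sq.
pose T : 'End(U) := l *: \1%VF - S.
have TE q : T q = l *: q - S q.
  by rewrite /T add_lfunE opp_lfunE scale_lfunE id_lfunE.
have dT q r : d (T q) r = l * d q r - d (S q) r.
  by rewrite TE linearBl /= linearZl_LR.
have T_psd : sym_psd d T.
  split=> [q r|q]; last by rewrite dT subr_ge0.
  by rewrite [RHS]dotC !dT (S_sym r) (dotC d r q) (dotC d r).
have [T_inj|T_ninj] := boolP (lker T == 0%VS); last first.
  apply/leigenvalueP; exists (vpick (lker T)); first by rewrite vpick0.
  by apply/eqP; rewrite eq_sym -subr_eq0 -TE -memv_ker memv_pick.
have [N N_gt0 V_le] := lfun_form_bounded d T^-1%VF.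
suff : sup E <= l - N^-1 by rewrite -/l lerBrDr gerDl leNgt invr_gt0 N_gt0.
apply: ge_sup => // _ [q q_neq0 <-].
have q_gt0 : 0 < d q q by rewrite dot_gt0.
rewrite ler_pdivrMr // mulrBl -[_ - _]subr0 -subr_ge0.
have := sym_psd_CauchySchwarz d T q (T^-1%VF q) T_psd.
rewrite T_psd.1 lker0_lfunVK // (dotC d q (T^-1%VF q)).
move=> CS; have := V_le q; have Tq_ge0 := T_psd.2 q.
move=> {}V_le.
suff : d q q <= N * d (T q) q.
  rewrite -ler_pdivrMl // dT; lra.
rewrite -(ler_pM2r q_gt0) -expr2; apply: (le_trans CS).
by rewrite mulrAC mulrC ler_wpM2r.
Qed.

(** The largest eigenvalue of [- S], with the opposite sign. *)
Lemma self_adjoint_lambda_min (S : 'End(U)) (q0 : U) : q0 != 0 ->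
  is_adjoint d d S S ->
  exists2 l, is_lambda_min S l & forall q, l * d q q <= d (S q) q.
Proof.
move=> q0_neq0 S_sym.
have NS_sym : is_adjoint d d (- S) (- S).
  by move=> q r; rewrite !opp_lfunE linearNl linearNr /= S_sym.
have eigN m : passmx.leigenvalue (- S) m = passmx.leigenvalue S (- m).
  apply/leigenvalueP/leigenvalueP => -[q q_neq0 Sq]; exists q => //.
    by rewrite scaleNr -Sq opp_lfunE opprK.
  by rewrite opp_lfunE Sq scaleNr opprK.
have [l [l_eig l_max] l_le] := self_adjoint_lambda_max _ _ q0_neq0 NS_sym.
exists (- l) => [|q]; last first.
  by rewrite mulNr lerNl -linearNl /= -opp_lfunE.
split=> [|m m_eig]; first by rewrite -eigN.
by rewrite lerNl l_max // eigN opprK.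
Qed.

End SelfAdjoint.

(** * Positive semidefinite operators *)

Section SymPsd.
Context {R : realFieldType} {V : vectType R} (d : {dot V for idfun}).
Variables (A : 'End(V)) (A_psd : sym_psd d A).

Let A_sym u v : d (A u) v = d u (A v). Proof. exact: A_psd.1. Qed.

(** Cauchy-Schwarz at [v] and [A v]. *)
Lemma sym_psd_eq0 v : d (A v) v = 0 -> A v = 0.
Proof.
move=> Avv; apply/eqP; rewrite -[_ == _]negbK -(dot_gt0 d) -leNgt.
have := sym_psd_CauchySchwarz d A v (A v) A_psd.
rewrite Avv mul0r; have := dot_ge0 d (A v); nra.
Qed.

Lemma orthov_limg_lker n : n \in orthov d (limg A) -> n \in lker A.
Proof.
move=> /mem_orthovP nA; rewrite memv_ker; apply/eqP.
apply: (dot_inj (dU := d)) => w; rewrite -A_sym linear0r dotC.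
by apply: nA; rewrite memv_img ?memvf.
Qed.

(** Provides, for every vector, a vector of the range with the same image:
    this is how the constraint [v \in limg A] of the formulas is met. *)
Lemma limg_lker_split v : exists2 r, r \in limg A & v - r \in lker A.
Proof.
have : v \in (limg A + orthov d (limg A))%VS by rewrite orthov_addv memvf.
case/memv_addP=> r rA [n nA ->]; exists r => //.
by rewrite addrC addKr orthov_limg_lker.
Qed.

Lemma orthov_lker_limg v : {in lker A, forall n, d v n = 0} -> v \in limg A.
Proof.
move=> v_ker; have [r rA nA] := limg_lker_split v.
have rn : d r (v - r) = 0.
  case/memv_imgP: rA nA => u _ ->; rewrite memv_ker A_sym => /eqP ->.
  by rewrite linear0r.
have : ~~ (0 < d (v - r) (v - r)).
  by rewrite linearBl /= v_ker // rn subrr ltxx.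
by rewrite dot_gt0 negbK subr_eq0 => /eqP ->.
Qed.

(** The range of [A] meets its null space, which is its orthogonal, trivially. *)
Lemma limg_gt0 v : v \in limg A -> v != 0 -> 0 < d (A v) v.
Proof.
move=> /memv_imgP[u _ ->]; set w := A u => w_neq0.
rewrite lt_neqAle A_psd.2 andbT eq_sym; apply: contra_neq w_neq0 => Aww.
have : ~~ (0 < d w w).
  by rewrite {1}/w A_sym (sym_psd_eq0 _ Aww) linear0r ltxx.
by rewrite dot_gt0 negbK => /eqP.
Qed.
End SymPsd.

(** * The form of a Schur complement *)

Section SchurComplement.
Context {R : realFieldType} {V U : vectType R}.
Variables (dV : {dot V for idfun}) (dU : {dot U for idfun}).
Variables (A Ap : 'End(V)) (C : 'Hom(V, U)) (Ct : 'Hom(U, V)).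
Hypotheses (A_psd : sym_psd dV A) (Ap_pinv : is_pseudoinverse A Ap).
Hypothesis C_adj : is_adjoint dV dU C Ct.
Hypothesis C_lker : (lker A <= lker C)%VS.

Let S : 'End(U) := (C \o Ap \o Ct)%VF.
Let T : 'Hom(U, V) := (Ap \o Ct)%VF.

Let A_sym u v : dV (A u) v = dV u (A v). Proof. exact: A_psd.1. Qed.

Let C_ker n : n \in lker A -> C n = 0.
Proof. by move/(subvP C_lker); rewrite memv_ker => /eqP. Qed.

Let SE p : S p = C (T p). Proof. by rewrite /S /T !comp_lfunE. Qed.

(** The values of [Ct] are orthogonal to [lker A], hence in the range of [A],
    where the pseudoinverse acts as a right inverse. *)
Let AT p : A (T p) = Ct p.
Proof.
rewrite /T comp_lfunE; apply: Ap_pinv; apply: (orthov_lker_limg dV _ A_psd) => n nA.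
by rewrite dotC -C_adj (C_ker _ nA) linear0l.
Qed.

Lemma schur_pairing p v : dU (C v) p = dV (A (T p)) v.
Proof. by rewrite C_adj AT dotC. Qed.

Lemma schur_energy p r : dU (S p) r = dV (A (T p)) (T r).
Proof. by rewrite SE schur_pairing A_sym dotC. Qed.

Lemma schur_sym_psd : sym_psd dU S.
Proof.
split=> [p r|p]; last by rewrite schur_energy A_psd.2.
by rewrite [RHS]dotC !schur_energy A_sym dotC.
Qed.

Lemma schur_gt0 p : lker Ct = 0%VS -> p != 0 -> 0 < dU (S p) p.
Proof.
move=> Ct_inj p_neq0; rewrite schur_energy lt_neqAle A_psd.2 andbT eq_sym.
apply: contra_neq p_neq0 => /(sym_psd_eq0 dV _ A_psd); rewrite AT => Ctp.
by apply/eqP; rewrite -memv0 -Ct_inj memv_ker Ctp.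
Qed.

(** The equality case of [schur_CauchySchwarz]: the component of [T p] in the
    range of [A]. *)
Lemma schur_realizer p :
  exists v, [/\ v \in limg A, C v = S p & dV (A v) v = dU (S p) p].
Proof.
have [v vA nA] := limg_lker_split dV _ A_psd (T p).
have Cv : C v = S p.
  by apply/esym/eqP; rewrite SE -subr_eq0 -linearB /= C_ker.
exists v; split=> //; rewrite -Cv schur_pairing; congr (dV _ _).
by apply/esym/eqP; rewrite -subr_eq0 -linearB /= -memv_ker.
Qed.

(** The Cauchy-Schwarz inequality of the form of [A] at [T p] and [v]. *)
Lemma schur_CauchySchwarz p v :
  dU (C v) p ^+ 2 <= dU (S p) p * dV (A v) v.
Proof.
by rewrite schur_pairing schur_energy; apply: sym_psd_CauchySchwarz.
Qed.

End SchurComplement.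

(** * The variational formulas *)

Lemma dnorm_sqr (R : rcfType) (U : vectType R) (d : {dot U for idfun}) u :
  dnorm d u ^+ 2 = d u u.
Proof. by rewrite sqr_sqrtr // dot_ge0. Qed.

Section EigenvalueFormulas.
Context {R : realType} {V U : vectType R}.
Variables (dV : {dot V for idfun}) (dU : {dot U for idfun}).
Variables (A Ap : 'End(V)) (C : 'Hom(V, U)) (Ct : 'Hom(U, V)).
Hypotheses (A_psd : sym_psd dV A) (Ap_pinv : is_pseudoinverse A Ap).
Hypothesis C_adj : is_adjoint dV dU C Ct.
Hypothesis C_lker : (lker A <= lker C)%VS.
Hypothesis Ct_inj : lker Ct = 0%VS.

Let S : 'End(U) := (C \o Ap \o Ct)%VF.
Let S_sym p r : dU (S p) r = dU p (S r).
Proof. exact: (schur_sym_psd dV dU A Ap C Ct A_psd Ap_pinv C_adj C_lker).1. Qed.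
Let S_gt0 p : p != 0 -> 0 < dU (S p) p.
Proof. exact: (schur_gt0 dV dU A Ap C Ct). Qed.
Let S_CS p v : dU (C v) p ^+ 2 <= dU (S p) p * dV (A v) v.
Proof. exact: (schur_CauchySchwarz dV dU A Ap C Ct). Qed.
Let S_real p : exists v, [/\ v \in limg A, C v = S p & dV (A v) v = dU (S p) p].
Proof. exact: (schur_realizer dV dU A Ap C Ct). Qed.

(** [schur_CauchySchwarz] at [p = C v] gives the upper bound, and the vector
    that realizes an eigenvector gives equality. *)
Lemma schur_lambda_max l : is_lambda_max S l ->
  (forall q, dU (S q) q <= l * dU q q) ->
  l%:E = ereal_sup [set (dnorm dU (C v) ^+ 2 / dV (A v) v)%:E
                     | v in [set v | v != 0 /\ v \in limg A]].
Proof.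
move=> [/leigenvalueP[p p_neq0 Sp] _] S_le.
have p_gt0 : 0 < dU p p by rewrite dot_gt0.
have l_gt0 : 0 < l by rewrite -(pmulr_lgt0 _ p_gt0) -linearZl_LR /= -Sp S_gt0.
apply/eqP; rewrite eq_le; apply/andP; split.
  have [v [vA Cv Av]] := S_real p.
  apply: ereal_sup_ubound; exists v.
    split=> //; apply: contraTneq (S_gt0 _ p_neq0) => v0.
    by rewrite -Av v0 linear0r ltxx.
  rewrite dnorm_sqr Cv Av Sp !linearZl_LR /= linearZr_LR /=.
  congr _%:E; field; rewrite !gt_eqF //.
apply: ge_ereal_sup => _ [v [v_neq0 vA] <-]; rewrite lee_fin dnorm_sqr.
have Av_gt0 := limg_gt0 dV A A_psd v vA v_neq0.
rewrite ler_pdivrMr //.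
have [->|Cv_neq0] := eqVneq (C v) 0.
  by rewrite linear0r mulr_ge0 // ltW.
have Cv_gt0 : 0 < dU (C v) (C v) by rewrite dot_gt0.
rewrite -(ler_pM2r Cv_gt0) -expr2 (le_trans (S_CS _ _)) // mulrAC.
by rewrite ler_wpM2r ?(ltW Av_gt0).
Qed.

(** For [q = S r], the vector realizing [r] has quotient
    [dU (S r) (S r) / dU (S r) r], and Cauchy-Schwarz with
    [l * dU r r <= dU (S r) r] makes it at least [l].  For an eigenvector [p],
    [schur_CauchySchwarz] bounds every quotient by [l]. *)
Lemma schur_lambda_min l : is_lambda_min S l ->
  (forall q, l * dU q q <= dU (S q) q) ->
  l%:E = ereal_inf
    [set ereal_sup [set (dnorm dU q ^+ 2 / dV (A v) v)%:E
                      | v in [set v | v \in limg A /\ C v = q]]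
       | q in [set q | q != 0]].
Proof.
move=> [/leigenvalueP[p p_neq0 Sp] _] S_ge.
have p_gt0 : 0 < dU p p by rewrite dot_gt0.
have l_gt0 : 0 < l by rewrite -(pmulr_lgt0 _ p_gt0) -linearZl_LR /= -Sp S_gt0.
apply/eqP; rewrite eq_le; apply/andP; split.
  apply: le_ereal_inf_tmp => _ [q q_neq0 <-].
  have S_inj : lker S == 0%VS.
    rewrite -subv0; apply/subvP => r; rewrite memv_ker memv0 => /eqP Sr.
    by apply/negPn/negP => /S_gt0; rewrite Sr linear0l ltxx.
  have [r Sr] : exists r, S r = q by exists (S^-1%VF q); rewrite lker0_lfunVK.
  have r_neq0 : r != 0.
    by apply: contraNneq q_neq0 => r0; rewrite -Sr r0 linear0.
  have [v [vA Cv Av]] := S_real r.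
  apply: (@le_trans _ _ (dnorm dU q ^+ 2 / dV (A v) v)%:E); last first.
    by apply: ereal_sup_ubound; exists v; rewrite // -Sr.
  rewrite lee_fin dnorm_sqr Av ler_pdivlMr ?S_gt0 // -Sr.
  have Sr_gt0 := S_gt0 _ r_neq0.
  have CS := dot_CauchySchwarz dU (S r) r.
  rewrite -(ler_pM2r Sr_gt0) -mulrA -expr2.
  apply: (@le_trans _ _ (l * (dU (S r) (S r) * dU r r))).
    by rewrite ler_pM2l.
  by rewrite mulrCA ler_wpM2l ?dot_ge0.
apply: (@le_trans _ _ (ereal_sup [set (dnorm dU p ^+ 2 / dV (A v) v)%:E
                      | v in [set v | v \in limg A /\ C v = p]])).
  by apply: ereal_inf_lbound; exists p.
apply: ge_ereal_sup => _ [v [vA Cv] <-]; rewrite lee_fin dnorm_sqr.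
have v_neq0 : v != 0.
  by apply: contraNneq p_neq0 => v0; rewrite -Cv v0 linear0.
rewrite ler_pdivrMr ?(limg_gt0 dV A A_psd) // -(ler_pM2r p_gt0) -expr2.
by have := S_CS p v; rewrite Cv Sp linearZl_LR /= mulrAC.
Qed.
End EigenvalueFormulas.

Lemma is_adjoint_comp (R : realFieldType) (U V W : vectType R)
    (dU : {dot U for idfun}) (dV : {dot V for idfun}) (dW : {dot W for idfun})
    (f : 'Hom(V, W)) (g : 'Hom(U, V)) ft gt :
  is_adjoint dV dW f ft -> is_adjoint dU dV g gt ->
  is_adjoint dU dW (f \o g)%VF (gt \o ft)%VF.
Proof. by move=> fP gP u w; rewrite !comp_lfunE fP gP. Qed.

Theorem theorem4p5 (R : realType) (V W : vectType R)
    (dV : {dot V for idfun}) (dW : {dot W for idfun})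
    (A : 'End(V)) (B : 'Hom(V, W)) (Ap : 'End(V)) :
  sym_psd dV A ->
  limg B = fullv ->
  (lker A :&: lker B)%VS = 0%VS ->
  is_pseudoinverse A Ap ->
  W0 dW A B != 0%VS ->
  let P := projW0 dW A B in
  let dW0 := subvs_dot dW (W0 dW A B) in
  let S := S0 dV dW A B Ap in
  (exists2 lmin : R, is_lambda_min S lmin &
     lmin%:E = ereal_inf
       [set ereal_sup
              [set (dnorm dW0 q ^+ 2 / dV (A v) v)%:E
                 | v in [set v | v \in limg A /\ P (B v) = q]]
          | q in [set q | q != 0]]) /\
  (exists2 lmax : R, is_lambda_max S lmax &
     lmax%:E = ereal_sup
       [set (dnorm dW0 (P (B v)) ^+ 2 / dV (A v) v)%:E
          | v in [set v | v != 0 /\ v \in limg A]]).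
Proof.
move=> A_psd B_surj _ Ap_pinv W0_neq0 P dW0 S.
pose C := (P \o B)%VF.
pose Ct := (adjoint dV dW B \o adjoint dW dW0 P)%VF.
have C_adj : is_adjoint dV dW0 C Ct by apply: is_adjoint_comp; apply: adjointP.
have S_eq : S = (C \o Ap \o Ct)%VF by rewrite /S /S0 /C /Ct !comp_lfunA.
(* [W0] is the orthogonal of the image by [B] of [lker A]. *)
have C_lker : (lker A <= lker C)%VS.
  apply/subvP => n nA; rewrite memv_ker comp_lfunE.
  apply/eqP; apply: (dot_inj (dU := dW0)) => q.
  rewrite linear0r dotC (adjointP dW dW0) adjoint_orthoproj dotC.
  by have /mem_orthovP := subvsP q; apply; apply: memv_img.
(* [B^t q = 0] makes [q] orthogonal to [limg B], the whole space. *)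
have Ct_inj : lker Ct = 0%VS.
  apply/eqP; rewrite -subv0; apply/subvP => q; rewrite memv_ker memv0 comp_lfunE.
  rewrite adjoint_orthoproj => /eqP Bq; apply/eqP/val_inj.
  apply: (dot_inj (dU := dW)) => w.
  have /memv_imgP[v _ ->] : w \in limg B by rewrite B_surj memvf.
  by rewrite (adjointP dV dW) Bq !linear0r.
have [q0 q0_neq0] : exists q : subvs_of (W0 dW A B), q != 0.
  exists (Subvs (memv_pick (W0 dW A B))).
  by rewrite -(inj_eq val_inj) /= vpick0.
have S_sym : is_adjoint dW0 dW0 S S.
  by rewrite S_eq; apply: (schur_sym_psd dV dW0 A Ap C Ct _ _ _ _).1.
have PB_C : (fun v => P (B v)) = C by apply/funext => v; rewrite [RHS]comp_lfunE.
split.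
  have [l l_min l_le] := self_adjoint_lambda_min dW0 S q0 q0_neq0 S_sym.
  exists l => //; move: l_min l_le; rewrite S_eq.
  pose G f := ereal_inf [set ereal_sup
              [set (dnorm dW0 q ^+ 2 / dV (A v) v)%:E
                 | v in [set v | v \in limg A /\ f v = q]]
          | q in [set q | q != 0]].
  rewrite -[ereal_inf _]/(G (fun v => P (B v))) PB_C.
  exact: schur_lambda_min.
have [l l_max l_ge] := self_adjoint_lambda_max dW0 S q0 q0_neq0 S_sym.
exists l => //; move: l_max l_ge; rewrite S_eq.
pose G f := ereal_sup [set (dnorm dW0 (f v) ^+ 2 / dV (A v) v)%:E
          | v in [set v | v != 0 /\ v \in limg A]].
rewrite -[ereal_sup _]/(G (fun v => P (B v))) PB_C.
exact: schur_lambda_max.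
Qed.
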